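(* Let $f\in\mathbb{R}\setminus\mathbb{Z}$. A minimal valid function $\pi$ is a facet if and only if for every minimal valid function $\pi'$, $E(\pi)\subseteq E(\pi')$ implies $\pi'=\pi$.
   Context: Fix $f\in\mathbb{R}\setminus\mathbb{Z}$. Let $\mathcal{Y}$ be the set of finite-support functions $y\colon\mathbb{R}\to\mathbb{Z}_{\ge 0}$ with $\sum_{r\in\mathbb{R}} r\,y(r)\equiv f \pmod 1$ (i.e. the difference is an integer). A function $\pi\colon\mathbb{R}\to\mathbb{R}$ is a valid function if $\pi\ge 0$ and $\sum_{r\in\mathbb{R}}\pi(r)y(r)\ge 1$ for all $y\in\mathcal{Y}$. It is minimal valid if, in addition, there is no valid function $\pi'\ne\pi$ with $\pi'\le\pi$ pointwise. By a theorem of Gomory and Johnson, the minimal valid functions are exactly the functions $\pi\colon\mathbb{R}\to\mathbb{R}_{\ge0}$ that are subadditive, periodic modulo $1$, and satisfy $\pi(0)=0$ and $\pi(x)+\pi(f-x)=1$ for all $x\in\mathbb{R}$. For a valid function $\pi$, let $P(\pi)=\{\,y\in\mathcal{Y} : \sum_{r}\pi(r)y(r)=1\,\}$. A valid function $\pi$ is a facet if for every valid function $\pi'$ with $P(\pi)\subseteq P(\pi')$ we have $\pi'=\pi$. The additivity domain of $\pi$ is $E(\pi)=\{(x,y)\in\mathbb{R}^2 : \pi(x)+\pi(y)=\pi(x+y)\}$. *)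

(* Defs.v *)
From HB Require Import structures.
From mathcomp Require Import all_boot all_order all_algebra finmap.
From mathcomp Require Import boolp classical_sets reals.

Set Implicit Arguments.
Unset Strict Implicit.
Unset Printing Implicit Defensive.

Import Order.TTheory GRing.Theory Num.Theory.

Local Open Scope classical_set_scope.
Local Open Scope ring_scope.

Section GroupRelaxation.
Variable R : realType.
Implicit Types (f : R) (g pi : R -> R) (y : {fsfun R -> nat with 0%N}).

Definition wsum g y : R := \sum_(r <- finsupp y) g r * (y r)%:R.

(* Membership in Num.int of the difference expresses congruence modulo 1. *)
Definition feasible f : set {fsfun R -> nat with 0%N} :=
  [set y | wsum id y - f \is a Num.int].

Definition valid_function f pi : Prop :=
  (forall x, 0 <= pi x) /\ (forall y, feasible f y -> 1 <= wsum pi y).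

Definition minimal_valid f pi : Prop :=
  valid_function f pi /\
  ~ exists pi', [/\ valid_function f pi', pi' <> pi & forall x, pi' x <= pi x].

Definition tight_solutions f pi : set {fsfun R -> nat with 0%N} :=
  [set y | feasible f y /\ wsum pi y = 1].

Definition facet f pi : Prop :=
  valid_function f pi /\
  forall pi', valid_function f pi' ->
    tight_solutions f pi `<=` tight_solutions f pi' -> pi' = pi.

Definition additivity_domain pi : set (R * R) :=
  [set p | pi p.1 + pi p.2 = pi (p.1 + p.2)].

End GroupRelaxation.

(* Main.v *)
Require Import Defs.
From mathcomp Require Import all_boot all_order all_algebra finmap.
From mathcomp Require Import boolp classical_sets reals.
From mathcomp Require Import ring lra.

(** A finite-support function [y] is a finite multiset of reals, so everything
    is done with lists: [y] is feasible when the list sums to [f] modulo 1, and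
    [wsum g y] is the sum of [g] along the list.  Cutting a list in two or
    replacing an entry by several others is then immediate.

    Both implications rest on the necessity half of the Gomory-Johnson theorem:
    a minimal valid [pi] satisfies [pi x <= \sum_(r <- t) pi r] whenever the list
    [t] sums to [x] modulo 1 ([minimal_le_sum]; taking [t] empty, a singleton or
    a pair gives [pi 0 = 0], periodicity and subadditivity), and satisfies
    [pi x + pi (f - x) = 1] ([minimal_symmetric]).  In both cases a violation
    would allow lowering [pi] at a single point.

    If [pi] is a facet and [E(pi)] is contained in [E(pi')], take a tight list
    for [pi].  It sums to [f] modulo 1 and [pi f = 1], so subadditivity of [pi]
    is an equality on it, hence an equality at each successive addition of an
    entry.  Those additive pairs are also additive for [pi'], which makes the
    list tight for [pi'] ([additive_sum_transfer]).  Hence [P(pi)] is contained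
    in [P(pi')] and the facet property gives [pi' = pi].

    Conversely let [pi'] be valid with [P(pi)] contained in [P(pi')].  The
    lists [x, f - x] are tight for [pi], hence for [pi'].  So [pi'] is
    symmetric, and a valid symmetric function is minimal
    ([symmetric_valid_minimal]): it cannot be lowered at [x] without breaking
    the constraint given by [x, f - x].  An additive pair [(x, y)] of [pi] is
    turned into the tight list [x, y, f - (x + y)]; tightness of this list for
    [pi'] says that [(x, y)] is additive for [pi']. *)

Set Implicit Arguments.
Unset Strict Implicit.
Unset Printing Implicit Defensive.

Import Order.TTheory GRing.Theory Num.Theory.

Local Open Scope classical_set_scope.
Local Open Scope ring_scope.

Section Multisets.
Variable R : realType.
Implicit Types (f x : R) (g pi : R -> R) (y : {fsfun R -> nat with 0%N}).
Implicit Types s t : seq R.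

Definition fsfun_of_seq s : {fsfun R -> nat with 0%N} :=
  [fsfun r in [fset r in s]%fset => count_mem r s].

Definition seq_of_fsfun y : seq R :=
  flatten [seq nseq (y r) r | r <- finsupp y].

Lemma fsfun_of_seqE s r : fsfun_of_seq s r = count_mem r s.
Proof.
rewrite fsfunE !inE; case: ifP => // /negbT rNs.
by apply/esym/count_memPn.
Qed.

Lemma wsum_fsfun_of_seq g s : wsum g (fsfun_of_seq s) = \sum_(r <- s) g r.
Proof.
rewrite /wsum -[RHS]big_undup_iterop_count.
rewrite (perm_big (undup s)) /=; last first.
  apply: uniq_perm; rewrite ?undup_uniq ?fset_uniq // => r.
  by rewrite mem_undup mem_finsupp fsfun_of_seqE -lt0n -has_count has_pred1.
apply: eq_bigr => r _; rewrite fsfun_of_seqE mulr_natr.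
by rewrite Monoid.iteropE iter_addr_0.
Qed.

Lemma sum_seq_of_fsfun g y : \sum_(r <- seq_of_fsfun y) g r = wsum g y.
Proof.
rewrite big_flatten big_map /=; apply: eq_bigr => r _.
by rewrite big_nseq iter_addr_0 mulr_natr.
Qed.

Definition feasible_seq f s := \sum_(r <- s) r - f \is a Num.int.

Lemma feasible_fsfun_of_seq f s :
  feasible f (fsfun_of_seq s) <-> feasible_seq f s.
Proof. by rewrite /feasible /= wsum_fsfun_of_seq. Qed.

Lemma feasible_seq_of_fsfun f y :
  feasible_seq f (seq_of_fsfun y) <-> feasible f y.
Proof. by rewrite /feasible_seq (sum_seq_of_fsfun id). Qed.

Lemma valid_functionP f pi : valid_function f pi <->
  (forall x, 0 <= pi x) /\
  (forall s, feasible_seq f s -> 1 <= \sum_(r <- s) pi r).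
Proof.
split=> -[pi0 pi1]; split=> //.
  by move=> s /feasible_fsfun_of_seq /pi1; rewrite wsum_fsfun_of_seq.
by move=> y; rewrite -sum_seq_of_fsfun => /feasible_seq_of_fsfun /pi1.
Qed.

Lemma tight_subsetP f pi pi' :
  tight_solutions f pi `<=` tight_solutions f pi' <->
  (forall s, feasible_seq f s ->
     \sum_(r <- s) pi r = 1 -> \sum_(r <- s) pi' r = 1).
Proof.
split=> [sub s fs s1|sub y [fy]].
  have : tight_solutions f pi (fsfun_of_seq s).
    by split; [apply/feasible_fsfun_of_seq | rewrite wsum_fsfun_of_seq].
  by move=> /sub[_]; rewrite wsum_fsfun_of_seq.
rewrite -sum_seq_of_fsfun => y1; split=> //.
by rewrite -sum_seq_of_fsfun; apply: sub => //; apply/feasible_seq_of_fsfun.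
Qed.

Lemma feasible_pair f x : feasible_seq f [:: x; f - x].
Proof.
rewrite /feasible_seq !big_cons big_nil (_ : _ - f = 0) ?rpred0 //; ring.
Qed.

End Multisets.

Section Minimal.
Variables (R : realType) (f : R).
Implicit Types (x y : R) (pi : R -> R) (s t : seq R).

Lemma minimal_valid_eq pi pi' : minimal_valid f pi -> valid_function f pi' ->
  (forall x, pi' x <= pi x) -> pi' = pi.
Proof.
move=> [_ nex] v' le; apply: contrapT => ne.
by apply: nex; exists pi'.
Qed.

(** Pulling a valid function back along a substitution of lists for points
    that preserves sums modulo 1: feasible lists go to feasible lists. *)
Lemma valid_subst pi (sigma : R -> seq R) : valid_function f pi ->
  (forall x, \sum_(r <- sigma x) r - x \is a Num.int) ->
  valid_function f (fun x => \sum_(r <- sigma x) pi r).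
Proof.
move=> /valid_functionP[pi0 pi1] sigmaP; apply/valid_functionP; split=> [x|s fs].
  by apply: sumr_ge0 => r _.
rewrite -(big_map sigma xpredT (fun u => \sum_(r <- u) pi r)) -big_flatten.
apply: pi1; rewrite /feasible_seq big_flatten big_map /=.
rewrite -[X in X - f](subrK (\sum_(r <- s) r)) -addrA rpredD //.
by rewrite -sumrB rpred_sum.
Qed.

(** Otherwise redirecting [x] to [t] would lower [pi] at [x] and nowhere else,
    and keep it valid. *)
Lemma minimal_le_sum pi x t : minimal_valid f pi ->
  \sum_(r <- t) r - x \is a Num.int -> pi x <= \sum_(r <- t) pi r.
Proof.
move=> mpi tx; rewrite leNgt; apply/negP => lt_t.
pose sigma z := if z == x then t else [:: z].
have E : (fun z => \sum_(r <- sigma z) pi r) = pi.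
  apply: minimal_valid_eq => //.
    apply: valid_subst => [|z]; first by case: mpi.
    by rewrite /sigma; case: eqP => [->|_] //; rewrite big_seq1 subrr rpred0.
  by move=> z; rewrite /sigma; case: eqP => [->|_]; rewrite ?big_seq1 // ltW.
by have := congr1 (@^~ x) E; rewrite /sigma eqxx => Ex; rewrite Ex ltxx in lt_t.
Qed.

Lemma minimal_ge0 pi x : minimal_valid f pi -> 0 <= pi x.
Proof. by move=> [[pi0 _] _]. Qed.

Lemma minimal0 pi : minimal_valid f pi -> pi 0 = 0.
Proof.
move=> mpi; apply/eqP; rewrite eq_le minimal_ge0 // andbT.
have := @minimal_le_sum pi 0 [::] mpi.
by rewrite !big_nil subrr; apply; apply: rpred0.
Qed.

Lemma minimal_periodic pi x y : minimal_valid f pi ->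
  x - y \is a Num.int -> pi x = pi y.
Proof.
move=> mpi xy; apply/eqP; rewrite eq_le.
have := @minimal_le_sum pi x [:: y] mpi; have := @minimal_le_sum pi y [:: x] mpi.
by rewrite !big_seq1 => -> // -> //; rewrite -opprB rpredN.
Qed.

Lemma minimal_subadditive pi x y : minimal_valid f pi ->
  pi (x + y) <= pi x + pi y.
Proof.
move=> mpi; have := @minimal_le_sum pi (x + y) [:: x; y] mpi.
by rewrite !big_cons !big_nil !addr0 subrr; apply; apply: rpred0.
Qed.

(** If [c := pi x + pi (f - x)] exceeded 1, then [pi] could be divided by [c]
    at [x]: a feasible list through [x] has [pi]-sum at least [c], because its
    other entries sum to [f - x] modulo 1, so its sum stays at least 1. *)
Lemma minimal_symmetric_neq0 pi x : minimal_valid f pi -> pi x != 0 ->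
  pi x + pi (f - x) = 1.
Proof.
move=> mpi pix0; have [/valid_functionP[pi0 pi1] _] := mpi.
set c := pi x + pi (f - x).
have c1 : 1 <= c.
  by have := pi1 _ (feasible_pair f x); rewrite !big_cons big_nil addr0.
apply/eqP; rewrite eq_le c1 andbT leNgt; apply/negP => c_gt1.
have c_gt0 : 0 < c by apply: lt_trans c_gt1.
have le_div z : pi z / c <= pi z by rewrite ler_pdivrMr // ler_peMr.
pose pi' z := if z == x then pi z / c else pi z.
have E : pi' = pi.
  apply: minimal_valid_eq => //; last by move=> z; rewrite /pi'; case: ifP.
  apply/valid_functionP; split=> [z|s fs].
    by rewrite /pi'; case: ifP => // _; rewrite divr_ge0 // ltW.
  have [xs|xNs] := boolP (x \in s); last first.
    rewrite (eq_big_seq pi) ?pi1 // => z zs; rewrite /pi' ifN //.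
    by apply: contraNneq xNs => <-.
  apply: (@le_trans _ _ (\sum_(r <- s) pi r / c)).
    rewrite -mulr_suml ler_pdivlMr // mul1r (perm_big _ (perm_to_rem xs)) /=.
    rewrite big_cons lerD2l; apply: minimal_le_sum => //.
    move: fs; rewrite /feasible_seq (perm_big _ (perm_to_rem xs)) /= big_cons.
    by rewrite opprB addrA [x + _]addrC.
  by apply: ler_sum => z _; rewrite /pi'; case: ifP.
have := congr1 (@^~ x) E; rewrite /pi' eqxx => Ex.
have : pi x / c < pi x.
  by rewrite ltr_pdivrMr // ltr_pMr // lt_neqAle eq_sym pix0 pi0.
by rewrite Ex ltxx.
Qed.

(** When [pi x] vanishes, validity at [x, f - x] gives [pi (f - x) >= 1], so
    the previous lemma applies at [f - x]. *)
Lemma minimal_symmetric pi x : minimal_valid f pi -> pi x + pi (f - x) = 1.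
Proof.
move=> mpi; have [pix0|] := eqVneq (pi x) 0; last exact: minimal_symmetric_neq0.
have [/valid_functionP[_ pi1] _] := mpi.
have := pi1 _ (feasible_pair f x); rewrite !big_cons big_nil addr0 pix0 add0r => ge1.
have := @minimal_symmetric_neq0 pi (f - x) mpi.
rewrite subKr pix0 addr0; apply.
by rewrite gt_eqF // (lt_le_trans ltr01).
Qed.

Lemma minimal_feasible pi s : minimal_valid f pi -> feasible_seq f s ->
  pi (\sum_(r <- s) r) = 1.
Proof.
move=> mpi fs; rewrite (minimal_periodic mpi fs).
by have := minimal_symmetric 0 mpi; rewrite minimal0 // add0r subr0.
Qed.

(** A valid function below [pi] still has sum at least 1 on every [x, f - x],
    where [pi] has sum exactly 1, so it cannot be smaller at [x]. *)
Lemma symmetric_valid_minimal pi : valid_function f pi ->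
  (forall x, pi x + pi (f - x) = 1) -> minimal_valid f pi.
Proof.
move=> vpi sym; split=> // -[pi' [/valid_functionP[_ v'] ne le]].
apply: ne; apply: funext => x; apply/eqP; rewrite eq_le le /=.
have := v' _ (feasible_pair f x); rewrite !big_cons big_nil addr0 => ge1.
have := sym x; have := le (f - x); lra.
Qed.

Lemma minimal_sum_le pi s : minimal_valid f pi ->
  pi (\sum_(r <- s) r) <= \sum_(r <- s) pi r.
Proof. by move=> mpi; apply: minimal_le_sum; rewrite ?subrr ?rpred0. Qed.

(** Equality in the iterated subadditivity of [pi] along a list forces equality
    at each of its steps, and each step is a pair in the additivity domain. *)
Lemma additive_sum_transfer pi pi' s :
  minimal_valid f pi -> minimal_valid f pi' ->
  additivity_domain pi `<=` additivity_domain pi' ->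
  \sum_(r <- s) pi r = pi (\sum_(r <- s) r) ->
  \sum_(r <- s) pi' r = pi' (\sum_(r <- s) r).
Proof.
move=> mpi mpi' sub; elim: s => [|x s IH];
  first by rewrite !big_nil (minimal0 mpi').
rewrite !big_cons => eq_s.
have le1 := minimal_subadditive x (\sum_(r <- s) r) mpi.
have le2 := minimal_sum_le s mpi.
rewrite IH; last by lra.
by apply: (sub (x, \sum_(r <- s) r)); rewrite /additivity_domain /=; lra.
Qed.

End Minimal.

Theorem theorem4p4 (R : realType) (f : R) (hf : f \isn't a Num.int)
    (pi : R -> R) (hpi : minimal_valid f pi) :
  facet f pi <->
  (forall pi' : R -> R, minimal_valid f pi' ->
     additivity_domain pi `<=` additivity_domain pi' -> pi' = pi).
Proof.
split=> [[_ fac] pi' mpi' subE|uniqE].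
  apply: fac; first by case: mpi'.
  apply/tight_subsetP => s fs s1.
  rewrite (additive_sum_transfer hpi mpi' subE) ?s1 ?(minimal_feasible mpi') //.
  by rewrite (minimal_feasible hpi).
split=> [|pi' vpi' /tight_subsetP subP]; first by case: hpi.
have sym x : pi' x + pi' (f - x) = 1.
  have := subP _ (feasible_pair f x).
  by rewrite !big_cons !big_nil !addr0; apply; apply: minimal_symmetric.
apply: uniqE => [|[x y]]; first exact: symmetric_valid_minimal.
rewrite /additivity_domain /= => addE.
have := subP [:: x; y; f - (x + y)].
rewrite /feasible_seq !big_cons !big_nil !addr0 => tight.
have symE := minimal_symmetric (x + y) hpi; have := sym (x + y).
have : pi' x + (pi' y + pi' (f - (x + y))) = 1.
  by apply: tight; [rewrite (_ : _ - f = 0) ?rpred0 //; ring | lra].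
lra.
Qed.
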